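(* Let $n\ge 0$. The three maps $\phi$, $\theta$, $\psi$ defined in the context are bijections: $$\phi:\{\text{perfect matchings of } H_{2n+1}\}\to T_n,\qquad \theta: T_n\to \mathcal{N}_{n+2},\qquad \psi:\{\text{perfect matchings of } H_{2n+1}\}\to \mathcal{N}_{n+2}.$$ Hence they give bijective correspondences among perfect matchings of the snake graph $G_{T,\gamma_{n+3}}\cong H_{2n+1}$, compatible pairs on the maximal Dyck path $\mathcal{D}^{(n+1)\times n}$, and nondecreasing Dyck paths of length $2n+4$.
   Context: Snake graph. For $m\ge1$ let $H_m$ be the ladder graph with vertices $A_0,\dots,A_m,B_0,\dots,B_m$ and edges $A_iB_i$ ($0\le i\le m$), $A_iA_{i+1}$ and $B_iB_{i+1}$ ($0\le i\le m-1$). For the annulus with one marked point on each boundary circle and triangulation $T=\{\tau_1,\tau_2\}$, the snake graph $G_{T,\gamma_{n+3}}$ of the arc $\gamma_{n+3}$ (which wraps $n+1$ times around the inner circle) is the graph $H_{2n+1}$ with this labelling. A perfect matching is a set of edges covering each vertex exactly once. Maximal Dyck path. $\mathcal{D}=\mathcal{D}^{(n+1)\times n}$ is the lattice path from $(0,0)$ to $(n+1,n)$ with vertices $A_0=(0,0)$, $A_1=B_0=(1,0)$ and, for $1\le i\le n$, $B_i=(i+1,i-1)$, $A_{i+1}=(i+1,i)$ (the highest unit up/right lattice path never going strictly above the segment from $(0,0)$ to $(n+1,n)$). Its horizontal edges are $u_i=A_iB_i$ ($0\le i\le n$), its vertical edges are $v_j=B_jA_{j+1}$ ($1\le j\le n$);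 $\mathcal{D}_1=\{u_0,\dots,u_n\}$, $\mathcal{D}_2=\{v_1,\dots,v_n\}$. Identify $(n+1,n)$ with $(0,0)$. For lattice points $P,Q$ of $\mathcal{D}$ the subpath $PQ$ is the part of $\mathcal{D}$ traversed from $P$ in the northeast direction until reaching $Q$, looping from $(n+1,n)$ back to $(0,0)$ if necessary (if $P=Q$, it is the whole loop from $P$ back to $P$); $(PQ)_1,(PQ)_2$ are its sets of horizontal and vertical edges, and $(PQ)^\circ$ is the set of lattice points on $PQ$ other than $P,Q$. A pair $(S_1,S_2)$ with $S_1\subseteq\mathcal{D}_1$, $S_2\subseteq\mathcal{D}_2$ is compatible if for every $u\in S_1$, $v\in S_2$, with $E$ the left endpoint of $u$ and $F$ the upper endpoint of $v$, there is $A\in(EF)^\circ$ with $|(AF)_1|=2|(AF)_2\cap S_2|$ or $|(EA)_2|=2|(EA)_1\cap S_1|$. $T_n$ denotes the set of compatible pairs on $\mathcal{D}^{(n+1)\times n}$. Nondecreasing Dyck paths. A Dyck path of length $2N$ is a sequence of $2N$ steps, each $(1,1)$ (''up'') or $(1,-1)$ (''down''), from $(0,0)$ to $(2N,0)$ staying in $\{y\ge0\}$. A valley is a point where a down step is followed by an up step. The path is nondecreasing if the altitudes ($y$-coordinates) of its valleys, read left to right, form a nondecreasing sequence. Cutting the path at its valleys divides it into consecutive mountains (from start to first valley, between consecutive valleys, and from the last valley to $(2N,0)$); the magnitude of a mountain is $(d,e)$ where $d$, $e$ are its numbers of up and down steps. A nondecreasing Dyck path is determined by its sequence of mountain magnitudes.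 $\mathcal{N}_N$ denotes the set of nondecreasing Dyck paths of length $2N$. The map $\phi$: $\phi(P)=(S_1,S_2)$ where $u_i\in S_1\iff A_{2i}A_{2i+1},B_{2i}B_{2i+1}\in P$ ($0\le i\le n$) and $v_i\in S_2\iff A_{2i-1}A_{2i},B_{2i-1}B_{2i}\in P$ ($1\le i\le n$). The map $\theta$: to $(S_1,S_2)\in T_n$ associate the word $\ell_0\ell_1\cdots\ell_n$ in letters $O,U,V$: $\ell_0=U$ if $u_0\in S_1$ and $\ell_0=O$ otherwise; for $1\le i\le n$, $\ell_i=O$ if $u_i\notin S_1,v_i\notin S_2$; $\ell_i=U$ if $u_i\in S_1,v_i\notin S_2$; $\ell_i=V$ if $u_i\notin S_1, v_i\in S_2$. Split the word into consecutive blocks, each of the form $U^{a}OV^{b}$ ($a,b\ge0$), followed by a final block $U^{c}$ ($c\ge 0$, possibly empty). If there are $k$ letters $O$ and the $i$-th block is $U^{a_i}OV^{b_i}$, then $\theta(S_1,S_2)$ is the Dyck path whose consecutive mountains have magnitudes $(a_i+b_i+1,\,a_i+1)$ for $1\le i\le k$, followed by a last mountain of magnitude $\big(n+2-\sum_{i=1}^k(a_i+b_i+1),\; n+2-\sum_{i=1}^k(a_i+1)\big)$. The map $\psi$: same as $\theta$ but with the word read from a perfect matching $P$ of $H_{2n+1}$: $\ell_0=U$ if $A_0A_1,B_0B_1\in P$ and $\ell_0=O$ otherwise; for $1\le i\le n$, $\ell_i=O$ if $A_{2i}B_{2i}\in P$, $\ell_i=U$ if $A_{2i}A_{2i+1},B_{2i}B_{2i+1}\in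 P$, $\ell_i=V$ if $A_{2i-1}A_{2i},B_{2i-1}B_{2i}\in P$. (Equivalently $\psi=\theta\circ\phi$.) *)

(* Defs.v *)
From HB Require Import structures.
From mathcomp Require Import all_boot all_order all_algebra.
From mathcomp Require Import boolp classical_sets functions.

Set Implicit Arguments.
Unset Strict Implicit.
Unset Printing Implicit Defensive.

Local Open Scope set_scope.

Definition vertex (m : nat) : finType := (bool * 'I_m.+1)%type.

(* Indices are always at most m below, where [inord] is the identity. *)
Definition vA (m i : nat) : vertex m := (false, inord i).
Definition vB (m i : nat) : vertex m := (true, inord i).

Definition rung (m i : nat) : {set vertex m} := [set vA m i; vB m i].
Definition railA (m i : nat) : {set vertex m} := [set vA m i; vA m i.+1].
Definition railB (m i : nat) : {set vertex m} := [set vB m i; vB m i.+1].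

Definition ladder_edges (m : nat) : {set {set vertex m}} :=
  [set rung m i | i : 'I_m.+1]
    :|: [set railA m i | i : 'I_m] :|: [set railB m i | i : 'I_m].

Definition perfect_matching (m : nat) (P : {set {set vertex m}}) : Prop :=
  P \subset ladder_edges m /\
  forall x : vertex m, #|[set e in P | x \in e]| = 1.

Definition perfect_matchings (m : nat) : set {set {set vertex m}} :=
  [set P | perfect_matching P]%classic.

Arguments perfect_matchings : clear implicits.

(* Truncated predecessor gives A_0 = (0,0) and A_1 = B_0 = (1,0). *)
Definition pA (i : nat) : nat * nat := (i, i.-1).
Definition pB (i : nat) : nat * nat := (i.+1, i.-1).

(* The lattice points A_0, A_1, B_1, A_2, B_2, ..., A_n, B_n of the path in
   northeast order; the endpoint A_{n+1} = (n+1,n) is omitted, being identified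
   with A_0 by [glue]. *)
Definition loop_points (n : nat) : seq (nat * nat) :=
  pA 0 :: flatten [seq [:: pA i; pB i] | i <- iota 1 n].

Definition glue (n : nat) (p : nat * nat) : nat * nat :=
  if p == (n.+1, n) then (0, 0) else p.

(* The points of the subpath PQ in order of traversal, starting with P and
   excluding the final Q; equivalently, the starting points of its edges. *)
Definition subpath (n : nat) (P Q : nat * nat) : seq (nat * nat) :=
  let c := rot (index P (loop_points n)) (loop_points n) in
  if P == Q then c else take (index Q c) c.

Definition interior (n : nat) (P Q : nat * nat) : seq (nat * nat) :=
  behead (subpath n P Q).

(* The ordinal i : 'I_n.+1 stands for the horizontal edge u_i, which starts at
   A_i, and j : 'I_n stands for the vertical edge v_{j+1}, which starts at
   B_{j+1} and ends at A_{j+2}. *)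
Definition hor (n : nat) (P Q : nat * nat) : {set 'I_n.+1} :=
  [set i : 'I_n.+1 | pA i \in subpath n P Q].
Definition ver (n : nat) (P Q : nat * nat) : {set 'I_n} :=
  [set j : 'I_n | pB j.+1 \in subpath n P Q].

Definition compatible (n : nat) (S : {set 'I_n.+1} * {set 'I_n}) : Prop :=
  forall (i : 'I_n.+1) (j : 'I_n), i \in S.1 -> j \in S.2 ->
    let E := pA i in
    let F := glue n (pA j.+2) in
    exists2 A, A \in interior n E F &
      #|hor n A F| = 2 * #|ver n A F :&: S.2| \/
      #|ver n E A| = 2 * #|hor n E A :&: S.1|.

Definition compatible_pairs (n : nat) : set ({set 'I_n.+1} * {set 'I_n}) :=
  [set S | compatible S]%classic.

Arguments compatible_pairs : clear implicits.

(* A path is its sequence of steps: [true] is up, [false] is down. *)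
Definition altitude (w : seq bool) (k : nat) : int :=
  (\sum_(s <- take k w) (if s then 1 else -1))%R.

Definition dyck_path (N : nat) (w : seq bool) : Prop :=
  [/\ size w = 2 * N,
      forall k, k <= size w -> (0 <= altitude w k)%R
    & altitude w (size w) = 0%R].

Definition valley (w : seq bool) (k : nat) : bool :=
  [&& 0 < k, k < size w, nth false w k.-1 == false & nth false w k == true].

Definition nondecreasing_path (w : seq bool) : Prop :=
  forall k l, valley w k -> valley w l -> k <= l ->
    (altitude w k <= altitude w l)%R.

Definition nondecreasing_dyck_paths (N : nat) : set (seq bool) :=
  [set w | dyck_path N w /\ nondecreasing_path w]%classic.

Arguments nondecreasing_dyck_paths : clear implicits.

Definition mountain (de : nat * nat) : seq bool :=
  nseq de.1 true ++ nseq de.2 false.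

Definition path_of_mountains (ms : seq (nat * nat)) : seq bool :=
  flatten [seq mountain de | de <- ms].

Inductive letter := LO | LU | LV.

Definition isV (l : letter) : bool := if l is LV then true else false.

(* The decomposition of a word into blocks U^a O V^b and a final U^c, returned
   as (the sequence of the pairs (a, b), c); see [split_blocksK]. *)
Fixpoint split_blocks (w : seq letter) : seq (nat * nat) * nat :=
  match w with
  | [::] => ([::], 0)
  | LU :: w' =>
      match split_blocks w' with
      | ((a, b) :: bs, c) => ((a.+1, b) :: bs, c)
      | ([::], c) => ([::], c.+1)
      end
  | LO :: w' =>
      let bc := split_blocks w' in
      ((0, find (predC isV) w') :: bc.1, bc.2)
  | LV :: w' => split_blocks w'
  end.

Definition block (ab : nat * nat) : seq letter :=
  nseq ab.1 LU ++ LO :: nseq ab.2 LV.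

Lemma split_blocksK (bs : seq (nat * nat)) (c : nat) :
  split_blocks (flatten [seq block ab | ab <- bs] ++ nseq c LU) = (bs, c).
Proof.
elim: bs => [|[a b] bs IH] /=; first by elim: c => //= c ->.
rewrite /block /= -!catA /=; set w := _ ++ nseq c LU in IH *.
elim: a => [|a IHa] /=; last by rewrite IHa.
have -> : split_blocks (nseq b LV ++ w) = (bs, c) by elim: b.
suff -> : find (predC isV) (nseq b LV ++ w) = b by [].
have w0 : find (predC isV) w = 0.
  by rewrite /w; case: (bs) => [|[[|a] b'] bs'] //=; case: (c).
by elim: b => //= b ->.
Qed.

Definition path_of_word (n : nat) (w : seq letter) : seq bool :=
  let bs := (split_blocks w).1 in
  path_of_mountains
    (rcons [seq (ab.1 + ab.2 + 1, ab.1 + 1) | ab <- bs]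
       (n + 2 - \sum_(ab <- bs) (ab.1 + ab.2 + 1),
        n + 2 - \sum_(ab <- bs) (ab.1 + 1))).

Definition phi (n : nat) (P : {set {set vertex (2 * n + 1)}}) :
    {set 'I_n.+1} * {set 'I_n} :=
  let m := 2 * n + 1 in
  ([set i : 'I_n.+1 | (railA m (2 * i) \in P) && (railB m (2 * i) \in P)],
   [set j : 'I_n | let i := j.+1 in
      (railA m (2 * i - 1) \in P) && (railB m (2 * i - 1) \in P)]).

(* The letter of index j + 1. A compatible pair never contains both u_i and v_i;
   the value LO given to this case is a dummy. *)
Definition theta_letter (n : nat) (S : {set 'I_n.+1} * {set 'I_n}) (j : 'I_n) :
    letter :=
  match lift ord0 j \in S.1, j \in S.2 with
  | false, false => LO
  | true, false => LU
  | false, true => LV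
  | true, true => LO
  end.

Definition theta_word (n : nat) (S : {set 'I_n.+1} * {set 'I_n}) :
    seq letter :=
  (if ord0 \in S.1 then LU else LO) ::
  [seq theta_letter S j | j <- enum 'I_n].

Definition theta (n : nat) (S : {set 'I_n.+1} * {set 'I_n}) : seq bool :=
  path_of_word n (theta_word S).

(* In a perfect matching exactly one of the three conditions holds; the final
   LO is a dummy. *)
Definition psi_letter (n : nat) (P : {set {set vertex (2 * n + 1)}})
    (i : nat) : letter :=
  let m := 2 * n + 1 in
  if rung m (2 * i) \in P then LO
  else if (railA m (2 * i) \in P) && (railB m (2 * i) \in P) then LU
  else if (railA m (2 * i - 1) \in P) && (railB m (2 * i - 1) \in P) then LV
  else LO.

Definition psi_word (n : nat) (P : {set {set vertex (2 * n + 1)}}) :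
    seq letter :=
  let m := 2 * n + 1 in
  (if (railA m 0 \in P) && (railB m 0 \in P) then LU else LO) ::
  [seq psi_letter P i | i <- iota 1 n].

Definition psi (n : nat) (P : {set {set vertex (2 * n + 1)}}) : seq bool :=
  path_of_word n (psi_word P).

(* Main.v *)
Require Import Defs.
From HB Require Import structures.
From mathcomp Require Import all_boot all_order all_algebra.
From mathcomp Require Import boolp classical_sets functions.
From mathcomp Require Import zify.

Set Implicit Arguments.
Unset Strict Implicit.
Unset Printing Implicit Defensive.

Local Open Scope set_scope.

(** A perfect matching of a ladder contains [A_k A_{k+1}] iff it contains
    [B_k B_{k+1}], so it amounts to a set of pairwise nonadjacent positions
    [k < 2n+1]; position [2i] encodes [u_i] and position [2i-1] encodes [v_i].
    Under this coding nonadjacency says that [v_{i+1}] excludes [u_i] and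
    [u_{i+1}], and a counting argument along the cyclic path shows that this is
    equivalent to compatibility.

    In terms of words it says that [V] is neither the first letter nor preceded
    by [U], i.e. that the word is a product of blocks [U^a O V^b] and a final
    [U^c]. Since the block [(a, b)] yields a mountain rising by [b] in total, the
    valleys have nondecreasing altitudes; conversely, all mountains but the last
    of a nondecreasing Dyck path satisfy [1 <= e <= d], hence come from a
    block. *)

(** * Perfect matchings of the ladder *)

(* The ordinal [j] stands for v_{j+1}. *)
Definition separated (n : nat) (S : {set 'I_n.+1} * {set 'I_n}) : Prop :=
  forall (i : 'I_n.+1) (j : 'I_n), i \in S.1 -> j \in S.2 ->
    (i != j :> nat) && (i != j.+1 :> nat).

Section Ladder.
Variable m : nat.

(** Merges [railA] (for [b = false]) and [railB] (for [b = true]), so that one argument serves both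
    sides. *)
Definition rail (b : bool) (k : nat) : {set vertex m} :=
  [set (b, inord k); (b, inord k.+1)].

Lemma vertex_eqE b b' k l : k <= m -> l <= m ->
  (((b, inord k) : vertex m) == (b', inord l)) = (b == b') && (k == l).
Proof.
move=> km lm; rewrite xpair_eqE; congr (_ && _).
by rewrite -val_eqE /= !inordK // ltnS.
Qed.

Lemma in_rung b k l : k <= m -> l <= m -> ((b, inord l) \in rung m k) = (l == k).
Proof. by move=> km lm; rewrite !inE !vertex_eqE //; case: b; rewrite ?orbF. Qed.

Lemma in_rail b b' k l : k < m -> l <= m ->
  ((b', inord l) \in rail b k) = (b' == b) && ((l == k) || (l == k.+1)).
Proof.
by move=> km lm; rewrite !inE !vertex_eqE ?(ltnW km) // -andb_orr.
Qed.

Lemma rung_inj k l : k <= m -> l <= m -> (rung m k == rung m l) = (k == l).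
Proof.
move=> km lm; apply/eqP/eqP => [E|->//].
by have := in_rung false km km; rewrite E in_rung // eqxx => /eqP.
Qed.

Lemma rail_inj b b' k l : k < m -> l < m ->
  (rail b k == rail b' l) = (b == b') && (k == l).
Proof.
move=> km lm; apply/eqP/andP => [E|[/eqP-> /eqP->]//].
have := in_rail b b km (ltnW km); rewrite E in_rail ?(ltnW km) // !eqxx /=.
move/andP=> [/eqP bb Hk]; subst b'.
(* One endpoint does not suffice, since neighbouring rails share a vertex; the endpoints [k] and
   [k.+1] together force [k = l]. *)
have := in_rail b b km km; rewrite E in_rail ?ltnS // !eqxx orbT /= => Hk'.
by split=> //; lia.
Qed.

(** A rung meets both sides, while a rail stays on its own; the vertex on side [~~ b] tells them
    apart. *)
Lemma rung_rail b k l : k <= m -> l < m -> (rung m k == rail b l) = false.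
Proof.
move=> km lm; apply/negP => /eqP E.
have := in_rung (~~ b) km km; rewrite E in_rail // eqxx.
by case: b {E}.
Qed.

Lemma in_ladder_edges e : reflect
  ((exists2 k, k <= m & e = rung m k) \/
   (exists b k, k < m /\ e = rail b k)) (e \in ladder_edges m).
Proof.
rewrite /ladder_edges !finset.in_setU; apply: (iffP idP).
  case/orP => [/orP[]|] /imsetP[k _ ->].
  - by left; exists k => //; rewrite -ltnS.
  - by right; exists false, k.
  - by right; exists true, k.
case=> [[k km ->]|[b [k [km ->]]]].
  by apply/orP; left; apply/orP; left; apply/imsetP; exists (Ordinal (n:=m.+1) (m:=k) km).
case: b; [apply/orP; right|apply/orP; left; apply/orP; right];
  by apply/imsetP; exists (Ordinal km).
Qed.

Lemma rung_ladder k : k <= m -> rung m k \in ladder_edges m.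
Proof. by move=> km; apply/in_ladder_edges; left; exists k. Qed.

Lemma rail_ladder b k : k < m -> rail b k \in ladder_edges m.
Proof. by move=> km; apply/in_ladder_edges; right; exists b, k. Qed.

Lemma card_incident (P : {set {set vertex m}}) b k :
  P \subset ladder_edges m -> k <= m ->
  #|[set e in P | (b, inord k) \in e]| =
  (rung m k \in P) + ((k < m) && (rail b k \in P))
  + ((0 < k) && (rail b k.-1 \in P)).
Proof.
move=> sP km.
(* All ladder edges at the vertex, without repetition; the tests drop the rail that is missing at
   either end of the ladder. *)
pose s := rung m k :: (if k < m then [:: rail b k] else [::])
  ++ (if 0 < k then [:: rail b k.-1] else [::]).
have us : uniq s.
  rewrite /s; case: ltnP => k1; case: ltnP => k2 //=; rewrite !inE ?rung_rail ?rail_inj //; lia.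
have -> : #|[set e in P | (b, inord k) \in e]| = #|[seq e <- s | e \in P]|.
  apply: eq_card => e; rewrite inE mem_filter; case eP: (e \in P) => //=.
  have /(fintype.subsetP sP)/in_ladder_edges[[l lm ->]|[b' [l [lm ->]]]] := eP.
    rewrite in_rung // /s inE rung_inj // mem_cat eq_sym.
    case: (l == k) => //=; case: ltnP => k1; case: ltnP => k2 //=; rewrite !inE ?rung_rail //; lia.
  rewrite in_rail // /s inE [rail _ _ == rung _ _]eq_sym rung_rail // mem_cat.
  by case: (ltnP k m) => k1; case: (ltnP 0 k) => k2 //=; rewrite !inE ?rail_inj; lia.
rewrite (card_uniqP (filter_uniq _ us)) size_filter /s /= count_cat addnA.
by case: ltnP => k1; case: ltnP => k2 //=; rewrite ?addn0.
Qed.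

Lemma perfect_matchingP (P : {set {set vertex m}}) :
  perfect_matching P <-> P \subset ladder_edges m /\
    forall b k, k <= m ->
      (rung m k \in P) + ((k < m) && (rail b k \in P))
      + ((0 < k) && (rail b k.-1 \in P)) = 1.
Proof.
split=> -[sP H]; split=> //.
  by move=> b k km; rewrite -card_incident.
case=> b k; rewrite -[k]inord_val card_incident ?H //; by rewrite -ltnS.
Qed.

(** Induction along the ladder: the two vertices of a column share their rung, and their previous
    rails agree, so covering each exactly once makes the next rails agree. *)
Lemma railAB (P : {set {set vertex m}}) b k : perfect_matching P -> k < m ->
  (rail b k \in P) = (rail false k \in P).
Proof.
case/perfect_matchingP=> _ H; elim: k => [|k IH] km.
  have := H b 0 (ltnW km); have := H false 0 (ltnW km).
  by rewrite km /=; case: (rung _ _ \in P); case: (rail b _ \in P); case: (rail _ _ \in P).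
have := H b k.+1 (ltnW km); have := H false k.+1 (ltnW km).
rewrite km /= IH ?(ltnW km) //.
by case: (rung _ _ \in P); case: (rail b _ \in P); case: (rail _ k.+1 \in P); case: (rail _ _ \in P).
Qed.

Lemma rail_nonadjacent (P : {set {set vertex m}}) b k :
  perfect_matching P -> k.+1 < m ->
  rail b k \in P -> rail b k.+1 \in P = false.
Proof.
case/perfect_matchingP=> _ H km Pk.
by have := H b k.+1 (ltnW km); rewrite km /= Pk; case: (rail _ k.+1 \in P); case: (rung _ _ \in P).
Qed.

Lemma rung_matching (P : {set {set vertex m}}) k : perfect_matching P -> k <= m ->
  (rung m k \in P) = ~~ (((k < m) && (rail false k \in P))
                         || ((0 < k) && (rail false k.-1 \in P))).
Proof.
case/perfect_matchingP=> _ /(_ false k) H km; move: (H km).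
by case: (rung _ _ \in P); case: (_ && (rail _ k \in P)); case: (_ && (rail _ k.-1 \in P)).
Qed.

(** The rails of one side determine everything: [railAB] gives the other side, and a rung is present
    exactly when no rail touches its column. *)
Lemma perfect_matching_inj (P Q : {set {set vertex m}}) :
  perfect_matching P -> perfect_matching Q ->
  (forall k, k < m -> (rail false k \in P) = (rail false k \in Q)) -> P = Q.
Proof.
move=> pP pQ H; apply/setP => e.
have sub R : perfect_matching R -> e \notin ladder_edges m -> (e \in R) = false.
  by move=> [sR _] ne; apply/negP => /(fintype.subsetP sR); apply/negP.
case eL: (e \in ladder_edges m); last by rewrite (sub _ pP) ?(sub _ pQ) ?eL.
have /in_ladder_edges[[k km ->]|[b [k [km ->]]]] := eL; last by rewrite (railAB _ pP) ?(railAB _ pQ) ?H.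
rewrite (rung_matching pP) ?(rung_matching pQ) //; congr (~~ (_ || _)).
  by case: ltnP => //= /H.
by case: k km => //= k km; rewrite H.
Qed.

(* Position [k] stands for the pair of rails between columns [k] and [k.+1]. *)
Definition matching_of (X : pred nat) : {set {set vertex m}} :=
  [set rung m k | k : 'I_m.+1 & ~~ ((k < m) && X k) && ~~ ((0 < k) && X k.-1)]
  :|: [set rail p.1 p.2 | p : bool * 'I_m & X p.2].

Lemma rung_matching_of X k : k <= m ->
  (rung m k \in matching_of X) = ~~ ((k < m) && X k) && ~~ ((0 < k) && X k.-1).
Proof.
move=> km; rewrite finset.in_setU; apply/orP/idP.
  case=> /imsetP[l]; rewrite inE => Xl /eqP.
    by rewrite (rung_inj km (leq_ord l)) => /eqP->.
  by rewrite rung_rail.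
by move=> Xk; left; apply/imsetP; exists (Ordinal (n:=m.+1) (m:=k) km); rewrite ?inE.
Qed.

Lemma rail_matching_of X b k : k < m -> (rail b k \in matching_of X) = X k.
Proof.
move=> km; rewrite finset.in_setU; apply/orP/idP.
  case=> /imsetP[l]; rewrite inE => Xl /eqP.
    by rewrite eq_sym (rung_rail _ (leq_ord l) km).
  by rewrite rail_inj // => /andP[_ /eqP->].
by move=> Xk; right; apply/imsetP; exists (b, Ordinal km); rewrite ?inE.
Qed.

Lemma perfect_matching_of (X : pred nat) :
  (forall k, k.+1 < m -> X k -> X k.+1 = false) -> perfect_matching (matching_of X).
Proof.
move=> HX; apply/perfect_matchingP; split.
  apply/fintype.subsetP => e; rewrite finset.in_setU => /orP[] /imsetP[k _ ->].
    by rewrite rung_ladder // -ltnS.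
  exact: rail_ladder.
move=> b k km; rewrite rung_matching_of //.
have -> : (k < m) && (rail b k \in matching_of X) = (k < m) && X k.
  by case: ltnP => // k1; rewrite rail_matching_of.
have -> : (0 < k) && (rail b k.-1 \in matching_of X) = (0 < k) && X k.-1.
  by case: k km => // k km; rewrite rail_matching_of.
case: k km => [|k] km /=; first by case: ((0 < m) && X 0).
have := HX k; case: ltnP => //= k1; last by case: (X k).
by move/(_ isT); case: (X k) => [->//|_]; case: (X k.+1).
Qed.

End Ladder.

(** * Pairs as sets of positions, and the map [phi] *)

Definition selected n (S : {set 'I_n.+1} * {set 'I_n}) (k : nat) : bool :=
  [exists i : 'I_n.+1, (i \in S.1) && (k == 2 * i)]
  || [exists j : 'I_n, (j \in S.2) && (k == (2 * j).+1)].

Lemma selected_even n (S : {set 'I_n.+1} * {set 'I_n}) (i : 'I_n.+1) :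
  selected S (2 * i) = (i \in S.1).
Proof.
apply/orP/idP => [[]/existsP[l /andP[Sl /eqP E]]|Si].
- by have -> : i = l by apply: val_inj => /=; lia.
- lia.
- by left; apply/existsP; exists i; rewrite Si eqxx.
Qed.

Lemma selected_odd n (S : {set 'I_n.+1} * {set 'I_n}) (j : 'I_n) :
  selected S (2 * j).+1 = (j \in S.2).
Proof.
apply/orP/idP => [[]/existsP[l /andP[Sl /eqP E]]|Si].
- lia.
- by have -> : j = l by apply: val_inj => /=; lia.
- by right; apply/existsP; exists j; rewrite Si eqxx.
Qed.

Section Phi.
Variable n : nat.
Let m := 2 * n + 1.

Lemma in_phi1 (P : {set {set vertex m}}) (i : 'I_n.+1) : perfect_matching P ->
  (i \in (phi P).1) = (rail m false (2 * i) \in P).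
Proof.
move=> pP; rewrite inE; have := @railAB m P true (2 * i) pP.
rewrite /rail /railA /railB /vA /vB => ->; first by rewrite andbb.
by rewrite /m; case: i => /= i; lia.
Qed.

Lemma in_phi2 (P : {set {set vertex m}}) (j : 'I_n) : perfect_matching P ->
  (j \in (phi P).2) = (rail m false (2 * j).+1 \in P).
Proof.
move=> pP; rewrite inE /=; have := @railAB m P true (2 * j).+1 pP.
have -> : 2 * j.+1 - 1 = (2 * j).+1 by lia.
rewrite /rail /railA /railB /vA /vB => ->; first by rewrite andbb.
by rewrite /m; case: j => /= j; lia.
Qed.

Lemma phi_inj (P Q : {set {set vertex m}}) : perfect_matching P -> perfect_matching Q ->
  phi P = phi Q -> P = Q.
Proof.
move=> pP pQ E; apply: perfect_matching_inj => // k km.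
have := odd_double_half k; case: (odd k) => /= Ek.
  have kn : k./2 < n by rewrite /m in km; lia.
  have -> : k = (2 * Ordinal kn).+1 by rewrite /=; lia.
  by rewrite -!in_phi2 // E.
have kn : k./2 < n.+1 by rewrite /m in km; lia.
have -> : k = 2 * Ordinal kn by rewrite /=; lia.
by rewrite -!in_phi1 // E.
Qed.

Lemma phi_separated (P : {set {set vertex m}}) : perfect_matching P -> separated (phi P).
Proof.
move=> pP i j; rewrite in_phi1 // in_phi2 // => Pi Pj; apply/andP; split; apply/eqP => ij.
  have lt : (2 * i).+1 < m by rewrite ij /m; case: (j) => /=; lia.
  by have := rail_nonadjacent pP lt Pi; rewrite ij Pj.
have lt : (2 * j).+2 < m by rewrite /m; case: (i) ij => /=; lia.
have := rail_nonadjacent pP lt Pj.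
have -> : (2 * j).+2 = 2 * i by lia.
by rewrite Pi.
Qed.

Lemma phi_surj S : separated S -> exists2 P, @perfect_matching m P & phi P = S.
Proof.
move=> sS; have pP : perfect_matching (matching_of m (selected S)).
  (* Adjacent positions have opposite parity, so one comes from [S.1] and the other from [S.2]; the
     two possible orders are the two exclusions in [separated]. *)
  apply: perfect_matching_of => k km /orP[]/existsP[l /andP[Sl /eqP E]];
    apply/negP => /orP[]/existsP[l' /andP[Sl' /eqP E']]; try lia.
    by have := sS _ _ Sl Sl'; lia.
  by have := sS _ _ Sl' Sl; lia.
exists (matching_of m (selected S)) => //.
rewrite [RHS]surjective_pairing [LHS]surjective_pairing; congr (_, _); apply/setP => i.
  by rewrite in_phi1 // rail_matching_of ?selected_even // /m; case: i => /= i; lia.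
by rewrite in_phi2 // rail_matching_of ?selected_odd // /m; case: i => /= i; lia.
Qed.

End Phi.
(** * Compatible pairs *)

(* The point of the loop at distance [r] from the origin along the path. *)
Definition loop_point (r : nat) : nat * nat :=
  if r is s.+1 then ((s.+1)./2.+1, s./2) else (0, 0).

Lemma loop_point_sum r : (loop_point r).1 + (loop_point r).2 = r.
Proof. by case: r => //= s; lia. Qed.

(** Every unit step raises the coordinate sum by one, so the sum recovers the index. *)
Lemma loop_point_inj : injective loop_point.
Proof. by move=> r s E; rewrite -(loop_point_sum r) E loop_point_sum. Qed.

Lemma pA_point i : pA i = loop_point (2 * i).-1.
Proof.
case: i => // i; have -> : (2 * i.+1).-1 = (2 * i).+1 by lia.
by congr (_, _) => /=; lia.
Qed.

Lemma pB_point j : pB j.+1 = loop_point (2 * j.+1).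
Proof.
have -> : 2 * j.+1 = (2 * j).+2 by lia.
by congr (_, _) => /=; lia.
Qed.

Lemma loop_pointsE n : loop_points n = map loop_point (iota 0 (2 * n + 1)).
Proof.
elim: n => // n IH; rewrite /loop_points -[X in iota 1 X]addn1 (iotaD 1 n 1) map_cat flatten_cat.
rewrite -cat_cons [_ :: _]IH; have -> : 2 * n.+1 + 1 = 2 * n + 1 + 2 by lia.
rewrite (iotaD 0 _ 2) map_cat; congr (_ ++ _).
have E1 : (2 * (1 + n)).-1 = 0 + (2 * n + 1) by lia.
have E2 : 2 * n.+1 = (0 + (2 * n + 1)).+1 by lia.
by rewrite /= pA_point (pB_point n) E1 E2.
Qed.

(** The indices from [p] up to [q], excluding [q], modulo the number [2 * n + 1] of points. The case
    [p = q] falls into the wrapping branch and gives the whole loop. *)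
Definition arc (n p q : nat) : seq nat :=
  if p < q then iota p (q - p) else iota p (2 * n + 1 - p) ++ iota 0 q.

Lemma index_iota_sub a k x : a <= x < a + k -> index x (iota a k) = x - a.
Proof.
move=> ax; have lt : x - a < size (iota a k) by rewrite size_iota; lia.
rewrite -{1}[x](_ : nth 0 (iota a k) (x - a) = x) ?index_uniq ?iota_uniq //.
by move: lt; rewrite size_iota => lt; rewrite nth_iota; lia.
Qed.

Lemma subpathE n p q : p < 2 * n + 1 -> q < 2 * n + 1 ->
  subpath n (loop_point p) (loop_point q) = map loop_point (arc n p q).
Proof.
move=> pN qN; rewrite /subpath loop_pointsE (index_map loop_point_inj) index_iota_sub //.
rewrite subn0 -map_rot (inj_eq loop_point_inj) (index_map loop_point_inj) -map_take.
rewrite /rot drop_iota take_iota add0n (minn_idPl (ltnW pN)) /arc.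
have [->|npq] := eqVneq p q; first by rewrite ltnn.
congr (map _ _); rewrite index_cat mem_iota size_iota.
case: (ltnP p q) => pq.
  have -> : p <= q < p + (2 * n + 1 - p) by lia.
  rewrite index_iota_sub; last by lia.
  by rewrite take_cat size_iota; case: ltnP => [_|]; [rewrite take_iota; congr iota|]; lia.
have -> : p <= q < p + (2 * n + 1 - p) = false by lia.
rewrite index_iota_sub; last by lia.
rewrite take_cat size_iota; case: ltnP => [|_]; first lia.
by rewrite take_iota; congr (_ ++ iota _ _); lia.
Qed.

(** The half-open cyclic interval from [p] to [q]. The length of the cycle does not occur, so it
    serves for points and for columns alike. *)
Definition on_arc (p q r : nat) : bool :=
  (p <= r < q) || (q <= p) && ((p <= r) || (r < q)).

Lemma mem_subpath n p q r : p < 2 * n + 1 -> q < 2 * n + 1 -> r < 2 * n + 1 ->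
  (loop_point r \in subpath n (loop_point p) (loop_point q)) = on_arc p q r.
Proof.
move=> pN qN rN; rewrite subpathE // (mem_map loop_point_inj) /arc /on_arc.
by case: ltnP => pq; rewrite ?mem_cat !mem_iota; lia.
Qed.

Lemma mem_interior n p q r : p < 2 * n + 1 -> q < 2 * n + 1 -> r < 2 * n + 1 ->
  (loop_point r \in interior n (loop_point p) (loop_point q)) = (r != p) && on_arc p q r.
Proof.
move=> pN qN rN; have := mem_subpath pN qN rN; rewrite /interior subpathE // behead_map.
have [t Et] : exists t, arc n p q = p :: t.
  rewrite /arc; case: ltnP => pq.
    by case Ed: (q - p) => [|d]; [lia|exists (iota p.+1 d)].
  by case Ed: (2 * n + 1 - p) => [|d]; [lia|exists (iota p.+1 d ++ iota 0 q)].
(* As the arc starts with [p] and visits it only once, [behead] removes exactly [p]. *)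
have : uniq (arc n p q).
  rewrite /arc; case: ltnP => pq; rewrite ?cat_uniq !iota_uniq //= andbT.
  by apply/hasPn => x; rewrite !mem_iota; lia.
rewrite Et /= => /andP[pt _]; rewrite inE (inj_eq loop_point_inj) !(mem_map loop_point_inj) => <-.
by case: eqVneq => [->|_] //=; apply: negbTE.
Qed.

Lemma interior_point n p q A : p < 2 * n + 1 -> q < 2 * n + 1 ->
  A \in interior n (loop_point p) (loop_point q) -> exists2 r, r < 2 * n + 1 & A = loop_point r.
Proof.
move=> pN qN /mem_behead; rewrite subpathE // => /mapP[r rA ->]; exists r => //.
by move: rA; rewrite /arc; case: ltnP => pq; rewrite ?mem_cat !mem_iota; lia.
Qed.

Lemma in_hor n p q (k : 'I_n.+1) : p < 2 * n + 1 -> q < 2 * n + 1 ->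
  (k \in hor n (loop_point p) (loop_point q)) = on_arc p q (2 * k).-1.
Proof.
by move=> pN qN; rewrite inE pA_point mem_subpath //; case: k => /=; lia.
Qed.

Lemma in_ver n p q (j : 'I_n) : p < 2 * n + 1 -> q < 2 * n + 1 ->
  (j \in ver n (loop_point p) (loop_point q)) = on_arc p q (2 * j.+1).
Proof.
by move=> pN qN; rewrite inE pB_point mem_subpath //; case: j => /=; lia.
Qed.

(* The distance from the origin of the upper endpoint of v_{j+1}, on the glued loop. *)
Definition top_index (n : nat) (j : 'I_n) : nat := if j.+1 == n then 0 else (2 * j + 3).

Lemma glue_point n (j : 'I_n) : Defs.glue n (pA j.+2) = loop_point (top_index j).
Proof.
rewrite /Defs.glue /top_index xpair_eqE /= eqSS andbb; case: eqP => // _.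
by rewrite pA_point; congr loop_point; lia.
Qed.

Lemma top_index_lt n (j : 'I_n) : top_index j < 2 * n + 1.
Proof. by rewrite /top_index; case: eqP; case: j => /=; lia. Qed.

(** If [i] is [j] or [j.+1], the path from E to F has at most two horizontal and two vertical edges.
    For A in its interior, AF contains the vertical edge of [j] but not the first horizontal edge,
    so at most one horizontal edge faces a right-hand side of at least 2; likewise EA has at most
    one vertical edge and contains the horizontal edge of [i]. *)
Lemma compatible_separated n (S : {set 'I_n.+1} * {set 'I_n}) :
  compatible S -> separated S.
Proof.
move=> cS i j Si Sj; apply/negP => /negP; rewrite negb_and !negbK => ij.
have [A] := cS i j Si Sj; rewrite pA_point glue_point.
have pN : (2 * i).-1 < 2 * n + 1 by case: (i) => /=; lia.
have qN := top_index_lt j => Aint; have [r rN EA] := interior_point pN qN Aint.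
move: Aint; rewrite {}EA mem_interior // => /andP[rp rI].
have jn := ltn_ord j; have iN := ltn_ord i.
case=> E.
  have : 0 < #|ver n (loop_point r) (loop_point (top_index j)) :&: S.2|.
    apply/card_gt0P; exists j; rewrite inE Sj in_ver // andbT.
    by move: rI; rewrite /on_arc /top_index; case: (j.+1 =P n); lia.
  have : #|hor n (loop_point r) (loop_point (top_index j))| <= 1.
    apply/card_le1_eqP => k l; rewrite !in_hor // => Hk Hl; apply: val_inj => /=.
    have kn := ltn_ord k; have ln := ltn_ord l.
    by move: rI Hk Hl; rewrite /on_arc /top_index; case: (j.+1 =P n); lia.
  by lia.
have : 0 < #|hor n (loop_point (2 * i).-1) (loop_point r) :&: S.1|.
  apply/card_gt0P; exists i; rewrite inE Si in_hor // andbT.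
  by move: rI; rewrite /on_arc /top_index; case: (j.+1 =P n); lia.
have : #|ver n (loop_point (2 * i).-1) (loop_point r)| <= 1.
  apply/card_le1_eqP => k l; rewrite !in_ver // => Hk Hl; apply: val_inj => /=.
  have kn := ltn_ord k; have ln := ltn_ord l.
  by move: rI Hk Hl; rewrite /on_arc /top_index; case: (j.+1 =P n); lia.
by lia.
Qed.

(** * Separated pairs are compatible: counting along columns *)

Lemma sum_neq (s0 t : nat) : \sum_(0 <= s < t) (s != s0) + (s0 < t) = t.
Proof.
elim: t => [|t IH]; first by rewrite big_nil.
by rewrite big_nat_recr //=; lia.
Qed.

(* If neither equality held, both differences would stay negative, as they start
   negative and increase by at most one per column; for the longest prefix and
   the longest suffix this yields more than [L.-1] indices [s] with [U s] or
   [V s.+1], although these exclude each other. *)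
Lemma balanced_column (L s0 : nat) (U V : pred nat) :
  1 < L -> U 0 -> V L.-1 -> (forall s, s.+1 < L -> U s -> ~~ V s.+1) ->
  exists2 t, 0 < t < L &
    L - t = 2 * \sum_(t <= s < L) V s \/
    \sum_(0 <= s < t) (s != s0) = 2 * \sum_(0 <= s < t) U s.
Proof.
move=> L1 U0 VL UV; apply: contrapT => no.
have pre t : 0 < t < L ->
    \sum_(0 <= s < t) (s != s0) < 2 * \sum_(0 <= s < t) U s.
  elim: t => // -[|t] IH tL; first by rewrite !big_nat1 U0; case: (_ != _).
  have : \sum_(0 <= s < t.+2) (s != s0) <> 2 * \sum_(0 <= s < t.+2) U s.
    by move=> E; apply: no; exists t.+2 => //; right.
  have e (F : nat -> nat) :
      \sum_(0 <= s < t.+2) F s = \sum_(0 <= s < t.+1) F s + F t.+1.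
    by rewrite big_nat_recr.
  have tL' : 0 < t.+1 < L by lia.
  by rewrite !e; move: (IH tL'); case: (_ != _); lia.
have suf d : 0 < d < L -> d < 2 * \sum_(L - d <= s < L) V s.
  elim: d => // -[|d] IH dL; first by rewrite subn1 big_ltn ?big_geq ?VL //; lia.
  have : d.+2 <> 2 * \sum_(L - d.+2 <= s < L) V s.
    by move=> E; apply: no; exists (L - d.+2); [lia|left; lia].
  have lt : L - d.+2 < L by lia.
  rewrite (big_ltn lt); have -> : (L - d.+2).+1 = L - d.+1 by lia.
  have dL' : 0 < d.+1 < L by lia.
  by move: (IH dL'); lia.
(* Doubled, the sum of [U] is at least [L.-1], because leaving out [s0] costs at most one, and the
   sum of [V] is at least [L]; the total exceeds [2 * L.-1]. *)
have := pre L.-1; have := suf L.-1; have := sum_neq s0 L.-1.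
have -> : L - L.-1 = 1 by lia.
have : \sum_(0 <= s < L.-1) U s + \sum_(1 <= s < L) V s <= L.-1.
  rewrite big_add1 -big_split /= -[X in _ <= X]subn0 -[X in _ <= X]muln1 -sum_nat_const_nat.
  rewrite !big_nat; apply: leq_sum => s sL; have := UV s.
  by case: (U s); case: (V s.+1) => // /(_ _ isT); lia.
by lia.
Qed.

(** Column [k] consists of u_k, starting at index [(2 * k).-1], followed by v_k, starting at
    [2 * k]. Subpaths between points [pA x] and [pA y] are made of whole columns, which reduces edge
    counts to cyclic intervals of columns. *)
Lemma on_arc_hor x y k : on_arc (2 * x).-1 (2 * y).-1 (2 * k).-1 = on_arc x y k.
Proof. by rewrite /on_arc; lia. Qed.

Lemma on_arc_ver x y k : on_arc (2 * x).-1 (2 * y).-1 (2 * k) = on_arc x y k.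
Proof. by rewrite /on_arc; lia. Qed.

Section Columns.
Variables (n i : nat).
Hypothesis iN : i < n.+1.

(** Renumbers the columns cyclically from column [i], where the subpath starts, so that cyclic
    intervals become ordinary ones. *)
Definition column (s : nat) : nat := (i + s) %% n.+1.

Lemma columnE s : s <= n.+1 -> column s = if i + s < n.+1 then i + s else i + s - n.+1.
Proof.
move=> sn; rewrite /column; case: ltnP => h; first by rewrite modn_small.
by rewrite -{1}(subnK h) modnDr modn_small; lia.
Qed.

Lemma on_arc_column a b s : a < b -> b <= n.+1 -> s < n.+1 ->
  on_arc (column a) (column b) (column s) = (a <= s < b).
Proof.
move=> ab bn sn; rewrite !columnE; try lia.
by case: (ltnP (i + a)) => ?; case: (ltnP (i + b)) => ?; case: (ltnP (i + s)) => ?;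
  rewrite /on_arc; lia.
Qed.

Lemma column_lt s : column s < n.+1.
Proof. exact: ltn_pmod. Qed.

Lemma sum_columns (Q : pred nat) :
  \sum_(k < n.+1) Q k = \sum_(0 <= s < n.+1) Q (column s).
Proof.
rewrite big_mkord; pose h (s : 'I_n.+1) : 'I_n.+1 := inord (column s).
rewrite (reindex_inj (h := h)) /=.
  by apply: eq_bigr => s _; rewrite /h inordK ?column_lt.
move=> s t /(congr1 val); rewrite /h /= !inordK ?column_lt // !columnE ?(ltnW (ltn_ord _)) // => E.
apply: val_inj; move: E (ltn_ord s) (ltn_ord t) => /=.
by case: ltnP => ?; case: ltnP => ?; lia.
Qed.

Lemma sum_restrict (Q X : pred nat) a b : b <= n.+1 ->
  (forall s, s < n.+1 -> Q s = (a <= s < b) && X s) ->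
  \sum_(0 <= s < n.+1) Q s = \sum_(a <= s < b) X s.
Proof.
move=> bn H; have [ab|ba] := leqP a b; last first.
  rewrite [RHS]big_geq ?(ltnW ba) // big_nat big1 // => s sn; rewrite H; lia.
rewrite (big_cat_nat (n := a)) //=; last by lia.
rewrite (big_cat_nat (m := a) (n := b)) //=.
rewrite [X in X + _]big_nat [X in X + _]big1; last by move=> s sn; rewrite H; lia.
rewrite [X in _ + (_ + X)]big_nat [X in _ + (_ + X)]big1; last by move=> s sn; rewrite H; lia.
rewrite add0n addn0 !big_nat; apply: eq_bigr => s sab; rewrite H; last by lia.
by rewrite sab.
Qed.

Lemma card_columns (B : {set 'I_n.+1}) (Q X : pred nat) a b : b <= n.+1 ->
  (forall k : 'I_n.+1, (k \in B) = Q k) ->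
  (forall s, s < n.+1 -> Q (column s) = (a <= s < b) && X s) ->
  #|B| = \sum_(a <= s < b) X s.
Proof.
move=> bn HB HQ; rewrite -sum1_card big_mkcond /= -(sum_restrict bn HQ) -sum_columns.
by apply: eq_bigr => k _; rewrite HB; case: (Q k).
Qed.

(** The ordinal [j] stands for the vertical edge of column [j.+1]; column 0 has none, whence the
    condition on [Q 0]. *)
Lemma card_columns_ver (B : {set 'I_n}) (Q X : pred nat) a b : b <= n.+1 ->
  (forall j : 'I_n, (j \in B) = Q j.+1) -> Q 0 = false ->
  (forall s, s < n.+1 -> Q (column s) = (a <= s < b) && X s) ->
  #|B| = \sum_(a <= s < b) X s.
Proof.
move=> bn HB Q0 HQ; rewrite -sum1_card big_mkcond /= -(sum_restrict bn HQ) -sum_columns.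
rewrite [RHS]big_ord_recl Q0 add0n.
by apply: eq_bigr => k _; rewrite HB /=; case: (Q _).
Qed.

End Columns.

(** It suffices to look for A among the starting points of columns. Each column has one horizontal
    edge and, apart from column 0, one vertical edge, so the two equalities of compatibility become
    those of [balanced_column]. *)
Lemma separated_compatible n (S : {set 'I_n.+1} * {set 'I_n}) :
  separated S -> compatible S.
Proof.
move=> sS i j Si Sj; rewrite /= pA_point glue_point.
have iN := ltn_ord i; have jn := ltn_ord j; have /andP[_ ij] := sS _ _ Si Sj.
(* The number of columns from E to F, the last being column [j.+1]; the second case passes through
   the origin. *)
pose L := if i <= j.+1 then j.+2 - i else n.+1 - i + j.+2.
have LE : (i <= j.+1) && (L == j.+2 - i) || (j.+1 < i) && (L == n.+1 - i + j.+2).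
  by rewrite /L; case: leqP; rewrite eqxx.
have L1 : 1 < L by lia.
have Ln : L <= n.+1 by lia.
pose c := column n i.
have cE s : s <= n.+1 -> (i + s < n.+1) && (c s == i + s)
                      || (n < i + s) && (c s == i + s - n.+1).
  by move=> sn; rewrite /c columnE //; case: ltnP; rewrite eqxx.
have c0 : c 0 = i by have := cE 0; lia.
have cL : c L.-1 = j.+1 by have := cE L.-1; lia.
(* When [j.+1 = n], F is glued to the origin, and [c L] is 0 accordingly. *)
have topE : top_index j = (2 * c L).-1.
  by rewrite /top_index; have := cE L Ln; case: (j.+1 =P n); lia.
have cn s : c s < n.+1 by exact: column_lt.
pose U s := selected S (2 * c s).
pose V s := (0 < c s) && selected S (2 * c s).-1.
(* The renumbered position of column 0, the one without a vertical edge. *)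
pose s0 := if i == 0 :> nat then 0 else n.+1 - i.
have s0E s : s < n.+1 -> (0 < c s) = (s != s0).
  by move=> sn; have := cE s; rewrite /s0; case: (i =P 0 :> nat); lia.
have [] := @balanced_column L s0 U V L1.
- by rewrite /U c0 selected_even.
- rewrite /V cL; have -> : (2 * j.+1).-1 = (2 * j).+1 by lia.
  by rewrite selected_odd Sj.
- move=> s sL; rewrite /U /V => Us; apply/negP => /andP[cs0 Vs].
  (* Otherwise the next column would be column 0, where [V] is false. *)
  have cs : c s < n by have := cE s; have := cE s.+1; lia.
  have cs' : c s.+1 = (c s).+1 by have := cE s; have := cE s.+1; lia.
  move: Us Vs; have -> : (2 * c s.+1).-1 = (2 * Ordinal cs).+1 by rewrite cs' /=; lia.
  rewrite selected_odd.
  have -> : 2 * c s = 2 * Ordinal (ltnW cs : c s < n.+1) by [].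
  rewrite selected_even => Us Vs.
  by have := sS _ _ Us Vs; rewrite /= eqxx.
move=> t /andP[t0 tL] Ht; have tn : t < n.+1 by lia.
have pN s : (2 * c s).-1 < 2 * n + 1 by have := cn s; lia.
rewrite topE -c0; exists (loop_point (2 * c t).-1).
  rewrite mem_interior // on_arc_hor on_arc_column ?(ltnW L1) // tL andbT.
  by have := cE t; rewrite c0; lia.
case: Ht => Ht; [left|right].
  rewrite (@card_columns n i iN _ (on_arc (c t) (c L)) predT t L) //; first last.
  - by move=> s sn; rewrite on_arc_column // andbT.
  - by move=> k; rewrite in_hor // on_arc_hor.
  rewrite (@card_columns_ver n i iN _ (fun k => on_arc (c t) (c L) k &&
     ((0 < k) && selected S (2 * k).-1)) V t L) ?andbF //; first last.
  - by move=> s sn; rewrite on_arc_column.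
  - move=> k; rewrite inE in_ver // on_arc_ver /=; congr (_ && _).
    by rewrite -selected_odd; congr (selected S _); lia.
  by rewrite -Ht sum_nat_const_nat muln1.
rewrite (@card_columns_ver n i iN _ (fun k => on_arc (c 0) (c t) k && (0 < k))
  (fun s => s != s0) 0 t) ?andbF ?(ltnW tn) //; first last.
- by move=> s sn; rewrite on_arc_column ?(ltnW tn) // s0E.
- by move=> k; rewrite in_ver // on_arc_ver andbT.
rewrite Ht (@card_columns n i iN _ (fun k => on_arc (c 0) (c t) k
   && selected S (2 * k)) U 0 t) ?(ltnW tn) //; first last.
- by move=> s sn; rewrite on_arc_column ?(ltnW tn).
- by move=> k; rewrite inE in_hor // on_arc_hor selected_even.
Qed.

(** * Words *)

Definition isU (l : letter) : bool := if l is LU then true else false.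

(** Mostly used as [path no_UV LU w], where the virtual letter [LU] in front also forbids a leading
    [LV]. *)
Definition no_UV (l l' : letter) : bool := ~~ (isU l && isV l').

Definition word_of (bc : seq (nat * nat) * nat) : seq letter :=
  flatten [seq block ab | ab <- bc.1] ++ nseq bc.2 LU.

Lemma size_word_of bs c :
  size (word_of (bs, c)) = \sum_(ab <- bs) (ab.1 + ab.2 + 1) + c.
Proof.
rewrite /word_of /= size_cat size_nseq; congr (_ + _).
elim: bs => [|[a b] bs IH] /=; first by rewrite big_nil.
by rewrite big_cons -IH /block !size_cat /= !size_nseq; lia.
Qed.

Lemma find_not_V w : path no_UV LU w -> find (predC isV) w = 0.
Proof. by case: w => [|[] w]. Qed.

(** [split_blocks] drops a leading run of [LV]; keeping that run as a separate factor makes the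
    induction work, since behind an [LO] it is the run counted in the new block, and behind an [LU]
    it is empty. *)
Lemma sorted_split_blocksK w : sorted no_UV w ->
  w = nseq (find (predC isV) w) LV ++ word_of (split_blocks w).
Proof.
elim: w => //= l w IH lw; have {}IH := IH (path_sorted lw).
case: l lw => [_|/find_not_V|_] /=.
- by rewrite {1}IH /word_of /= /block -catA.
- move=> f0; rewrite {1}IH f0 /=.
  by case: (split_blocks w) => -[|[a b] bs] c.
- by rewrite {1}IH.
Qed.

Lemma split_blocks_goodK w : path no_UV LU w -> word_of (split_blocks w) = w.
Proof.
move=> gw; rewrite [RHS](sorted_split_blocksK (path_sorted gw)).
by rewrite find_not_V.
Qed.

Lemma path_word_of l bc : path no_UV l (word_of bc).
Proof.
have pU l' c w : (forall l, path no_UV l w) -> path no_UV l' (nseq c LU ++ w).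
  by move=> pw; elim: c l' => //= c IH l'; rewrite IH andbT /no_UV andbF.
have pV l' b w : (forall l, path no_UV l w) -> ~~ isU l' -> path no_UV l' (nseq b LV ++ w).
  by move=> pw; elim: b l' => [|b IH] l' nU //=; rewrite IH // /no_UV (negbTE nU).
case: bc => bs c; rewrite /word_of /=; elim: bs l => [|[a b] bs IH] l /=.
  by rewrite -[nseq c LU]cats0 pU.
rewrite /block -!catA; apply: pU => {}l /=; rewrite {1}/no_UV andbF /=.
exact: pV.
Qed.

(** * Separated pairs as words *)

Section Theta_word.
Variable n : nat.
Implicit Type S : {set 'I_n.+1} * {set 'I_n}.

Lemma size_theta_word S : size (theta_word S) = n.+1.
Proof. by rewrite /= size_map size_enum_ord. Qed.

Lemma nth_theta_word S (j : 'I_n) : nth LO (theta_word S) j.+1 = theta_letter S j.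
Proof. by rewrite /= (nth_map j) ?nth_ord_enum // size_enum_ord. Qed.

Lemma theta_letter_cases S (j : 'I_n) : separated S ->
  theta_letter S j = if lift ord0 j \in S.1 then LU else if j \in S.2 then LV else LO.
Proof.
move=> sS; rewrite /theta_letter.
case Si: (_ \in S.1); case Sj: (j \in S.2) => //.
by have := sS _ _ Si Sj; rewrite /= /bump eqxx andbF.
Qed.

Lemma isU_theta_word S (i : 'I_n.+1) : separated S ->
  isU (nth LO (theta_word S) i) = (i \in S.1).
Proof.
move=> sS; case: (unliftP ord0 i) => [j|] ->; last by rewrite /theta_word /=; case: (_ \in _).
have -> : lift ord0 j = j.+1 :> nat by [].
by rewrite nth_theta_word theta_letter_cases //; case: (_ \in _) => //; case: (_ \in _).
Qed.

Lemma isV_theta_word S (j : 'I_n) : separated S ->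
  isV (nth LO (theta_word S) j.+1) = (j \in S.2).
Proof.
move=> sS; rewrite nth_theta_word theta_letter_cases //.
case Si: (_ \in S.1); case Sj: (j \in S.2) => //.
by have := sS _ _ Si Sj; rewrite /= /bump eqxx andbF.
Qed.

Lemma theta_word_inj S S' : separated S -> separated S' ->
  theta_word S = theta_word S' -> S = S'.
Proof.
move=> sS sS' E; rewrite [S]surjective_pairing [S']surjective_pairing.
congr (_, _); apply/setP => k.
  by rewrite -!isU_theta_word // E.
by rewrite -!isV_theta_word // E.
Qed.

Lemma theta_word_good S : separated S -> path no_UV LU (theta_word S).
Proof.
move=> sS; apply/(pathP LO) => -[|k]; rewrite size_theta_word => kn.
  by rewrite /theta_word /=; case: (_ \in _).
have kn' : k < n by [].
apply/negP => /andP.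
have -> : nth LO (LU :: theta_word S) k.+1 = nth LO (theta_word S) (Ordinal (ltnW kn)) by [].
have -> : nth LO (theta_word S) k.+1 = nth LO (theta_word S) (Ordinal kn').+1 by [].
rewrite isU_theta_word // isV_theta_word // => -[Si Sj].
by have := sS _ _ Si Sj; rewrite /= eqxx.
Qed.

Definition pair_of_word (w : seq letter) : {set 'I_n.+1} * {set 'I_n} :=
  ([set i : 'I_n.+1 | isU (nth LO w i)], [set j : 'I_n | isV (nth LO w j.+1)]).

Lemma pair_of_word_separated w : path no_UV LU w -> size w = n.+1 ->
  separated (pair_of_word w).
Proof.
move=> /(pathP LO) gw sw i j; rewrite !inE => Ui Vj; apply/andP; split; apply/eqP => ij.
  have := gw j.+1; rewrite sw ltnS => /(_ (ltn_ord j)) /=.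
  by rewrite -ij /no_UV Ui ij Vj.
by move: Ui Vj; rewrite ij; case: (nth _ _ _).
Qed.

Lemma pair_of_wordK w : path no_UV LU w -> size w = n.+1 ->
  theta_word (pair_of_word w) = w.
Proof.
move=> gw sw; apply: (@eq_from_nth _ LO); rewrite size_theta_word // => -[|k] kn.
  by rewrite /theta_word /= inE /=; case: w gw sw => [|[] w].
have kn' : k < n by [].
have -> : k.+1 = (Ordinal kn').+1 by [].
rewrite nth_theta_word theta_letter_cases; last exact: pair_of_word_separated.
by rewrite !inE /=; case: (nth _ _ _).
Qed.

End Theta_word.

(** * Nondecreasing Dyck paths *)

(* [h] is the altitude of the starting point. *)
Fixpoint blocks_path (h : nat) (bs : seq (nat * nat)) (c : nat) : seq bool :=
  if bs is (a, b) :: bs' then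
    mountain (a + b + 1, a + 1) ++ blocks_path (h + b) bs' c
  else mountain (c + 1, c + 1 + h).

Lemma size_mountain d e : size (mountain (d, e)) = d + e.
Proof. by rewrite size_cat !size_nseq. Qed.

Lemma size_blocks_path h bs c : size (blocks_path h bs c) =
  2 * (\sum_(ab <- bs) (ab.1 + ab.2 + 1) + c + 1) + h.
Proof.
elim: bs h => [|[a b] bs IH] h /=.
  by rewrite big_nil size_mountain; lia.
by rewrite big_cons size_cat size_mountain IH /=; lia.
Qed.

Lemma path_of_wordE n w : path no_UV LU w -> size w = n.+1 ->
  path_of_word n w = blocks_path 0 (split_blocks w).1 (split_blocks w).2.
Proof.
move=> gw sw; rewrite /path_of_word /path_of_mountains.
have := sw; rewrite -{1}(split_blocks_goodK gw); case: (split_blocks w) => bs c /=.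
rewrite size_word_of => Hn; pose f (ab : nat * nat) := (ab.1 + ab.2 + 1, ab.1 + 1).
(* As the word has length [n.+1], the differences from [n + 2] are [c + 1] up steps, and [c + 1]
   plus the total rise for the down steps. The altitude [h] is general for the induction. *)
suff gen h : blocks_path h bs c = flatten [seq mountain de | de <-
    rcons (map f bs) (c + 1, h + c + 1 + \sum_(ab <- bs) ab.2)].
  rewrite gen; congr (flatten (map _ (rcons _ (_, _)))); first by lia.
  have : \sum_(ab <- bs) (ab.1 + ab.2 + 1) =
      \sum_(ab <- bs) (ab.1 + 1) + \sum_(ab <- bs) ab.2.
    by rewrite -big_split; apply: eq_bigr => ab _ /=; lia.
  by lia.
elim: bs h {Hn} => [|[a b] bs IH] h /=.
  by rewrite big_nil cats0; congr (mountain (_, _)); lia.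
rewrite IH big_cons /=; congr (_ ++ flatten (map _ (rcons _ (_, _)))); lia.
Qed.

(** The head conditions say that each remainder is empty or starts with the other letter, so both
    sides split off the same maximal run. *)
Lemma nseq_cat_inj (x : bool) d d' s s' :
  head (~~ x) s = ~~ x -> head (~~ x) s' = ~~ x ->
  nseq d x ++ s = nseq d' x ++ s' -> d = d' /\ s = s'.
Proof.
move=> hs hs'; elim: d d' => [|d IH] [|d'] //=.
- by move=> E; move: hs; rewrite E /=; case: (x).
- by move=> E; move: hs'; rewrite -E /=; case: (x).
- by case=> /IH[-> ->].
Qed.

Lemma head_blocks_path b h bs c : head b (blocks_path h bs c) = true.
Proof. by case: bs => [|[a b'] bs] /=; rewrite addn1. Qed.

Lemma mountain_cat_inj d e d' e' w w' : 0 < e -> 0 < e' ->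
  head true w = true -> head true w' = true ->
  mountain (d, e) ++ w = mountain (d', e') ++ w' -> [/\ d = d', e = e' & w = w'].
Proof.
move=> e0 e0' hw hw'; rewrite /mountain /= -!catA => /nseq_cat_inj[] //.
- by case: (e) e0.
- by case: (e') e0'.
- by move=> -> /nseq_cat_inj[] // -> ->.
Qed.

Lemma blocks_path_inj h h' bs bs' c c' :
  blocks_path h bs c = blocks_path h' bs' c' -> bs = bs' /\ c = c'.
Proof.
elim: bs h h' bs' => [|[a b] bs IH] h h' [|[a' b'] bs'] /=.
- rewrite -[mountain (c + 1, _)]cats0 -[mountain (c' + 1, _)]cats0.
  move/mountain_cat_inj => [] //; try lia.
  by move=> E1 _ _; split=> //; lia.
- rewrite -[mountain (c + 1, _)]cats0 => /mountain_cat_inj[]; rewrite ?head_blocks_path //; try lia.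
  (* With default [false], a head equal to [true] proves the remaining path nonempty, so it cannot
     match the end of a last mountain. *)
  by move=> _ _ E; have := head_blocks_path false (h' + b') bs' c'; rewrite -E.
- rewrite -[mountain (c' + 1, _)]cats0 => /mountain_cat_inj[]; rewrite ?head_blocks_path //; try lia.
  by move=> _ _ E; have := head_blocks_path false (h + b) bs c; rewrite E.
- move=> /mountain_cat_inj[]; rewrite ?head_blocks_path //; try lia.
  move=> E1 E2 /IH[-> ->]; split=> //; congr ((_, _) :: _); lia.
Qed.

(** * Altitudes and valleys along mountains *)

Lemma altitude_cat s w k :
  altitude (s ++ w) (size s + k) = (altitude s (size s) + altitude w k)%R.
Proof.
by rewrite /altitude take_cat ltnNge leq_addr /= addKn big_cat take_size.
Qed.

Lemma altitude_catl s w k : k <= size s -> altitude (s ++ w) k = altitude s k.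
Proof. by move=> ks; rewrite /altitude takel_cat. Qed.

Lemma altitude_nseq (b : bool) d k : k <= d ->
  altitude (nseq d b) k = (if b then k%:Z else - k%:Z)%R.
Proof.
move=> kd; rewrite /altitude take_nseq //.
elim: k kd => [|k IH] kd /=; first by rewrite big_nil; case: b.
by rewrite big_cons IH ?(ltnW kd) //; case: (b) => /=; lia.
Qed.

Lemma altitude_mountain d e k : k <= d + e ->
  altitude (mountain (d, e)) k = (if (k <= d)%N then k%:Z else d%:Z + d%:Z - k%:Z)%R.
Proof.
move=> kde; rewrite /mountain /=; case: leqP => kd.
  by rewrite altitude_catl ?size_nseq // altitude_nseq.
have -> : k = size (nseq d true) + (k - d) by rewrite size_nseq; lia.
rewrite altitude_cat size_nseq.
by rewrite !altitude_nseq //; lia.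
Qed.

Lemma altitude_mountain_cat d e w k :
  altitude (mountain (d, e) ++ w) (d + e + k) = (d%:Z - e%:Z + altitude w k)%R.
Proof.
rewrite -(size_mountain d e) altitude_cat size_mountain altitude_mountain //.
by case: leqP; lia.
Qed.

(** A mountain has no valley of its own. The default [true] lets [w] be empty; otherwise [w] starts
    upwards, and the junction is a valley. *)
Lemma valley_mountain_cat d e w k : 0 < e -> head true w = true ->
  valley (mountain (d, e) ++ w) k =
  (k == d + e) && (0 < size w) || (d + e < k) && valley w (k - (d + e)).
Proof.
move=> e0 hw.
have nthE l : nth false (mountain (d, e) ++ w) l =
    (l < d) || (d + e <= l) && nth false w (l - (d + e)).
  rewrite nth_cat size_mountain /mountain /= nth_cat size_nseq !nth_nseq.
  have [ld|dl] := ltnP l d; first by have -> : l < d + e by lia.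
  by case: ltnP => //; case: ifP.
rewrite /valley !nthE size_cat size_mountain.
have [klt|klt|->] := ltngtP k (d + e); last first.
- have -> : d + e <= (d + e).-1 = false by lia.
  rewrite ?leqnn subnn ?ltnn; case: w hw {nthE} => [|b w] /= hw.
    by rewrite addn0 ltnn !andbF.
  by rewrite hw orbT; lia.
- have -> : k.-1 - (d + e) = (k - (d + e)).-1 by lia.
  have -> : (k < d) = false by lia.
  have -> : (k.-1 < d) = false by lia.
  have -> : d + e <= k.-1 by lia.
  by rewrite /= ?(ltnW klt) /=; congr [&& _, _, _ & _]; lia.
- have [] := boolP (k < d) => /=; first by have [] := boolP (k.-1 < d) => //; lia.
  by rewrite /= ?andbF.
Qed.
(* The conditions on the part of a nondecreasing Dyck path that follows a valley
   of altitude [h]. *)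
Definition nondecreasing_from (h : nat) (w : seq bool) : Prop :=
  [/\ forall k, k <= size w -> (0 <= h%:Z + altitude w k)%R,
      (h%:Z + altitude w (size w) = 0)%R,
      forall k, valley w k -> (0 <= altitude w k)%R
    & nondecreasing_path w].

Lemma nondecreasing_from_mountain h d e : 0 < e ->
  nondecreasing_from h (mountain (d, e)) <-> e = d + h.
Proof.
move=> e0; have noV k : valley (mountain (d, e)) k = false.
  by rewrite -[mountain _]cats0 valley_mountain_cat //= /valley /= !andbF.
split=> [[_]|Ee].
  by rewrite size_mountain altitude_mountain //; case: leqP; lia.
split=> [k||k|k l]; rewrite ?noV ?size_mountain //.
  by move=> kde; rewrite altitude_mountain //; case: leqP; lia.
by rewrite altitude_mountain //; case: leqP; lia.
Qed.

(** The junction is the first valley, at altitude [d - e] relative to the start, so [e <= d] and the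
    subtraction is exact; the later valleys are then compared with this new base altitude. *)
Lemma nondecreasing_from_mountain_cat h d e w : 0 < e -> head false w = true ->
  nondecreasing_from h (mountain (d, e) ++ w) <->
  e <= d /\ nondecreasing_from (h + (d - e)) w.
Proof.
move=> e0 hw; have hw' : head true w = true by case: w hw.
have w0 : 0 < size w by case: w hw {hw'}.
(* The index [k = 0] stands for the junction itself. *)
have valE k : valley (mountain (d, e) ++ w) (d + e + k) = (k == 0) || valley w k.
  rewrite valley_mountain_cat // w0 andbT; case: k => [|k]; first by rewrite addn0 eqxx.
  have -> : d + e + k.+1 - (d + e) = k.+1 by lia.
  have -> : d + e < d + e + k.+1 by lia.
  by case: (valley w _) => /=; lia.
split=> [[pos fin val mono]|[ed [pos fin val mono]]].
  have ed : e <= d.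
    have := val (d + e + 0); rewrite valE altitude_mountain_cat /altitude take0 big_nil.
    by move=> /(_ isT); lia.
  split=> //; split.
  - move=> k kw; have := pos (d + e + k); rewrite altitude_mountain_cat size_cat size_mountain.
    by move=> /(_ _); lia.
  - by move: fin; rewrite size_cat size_mountain altitude_mountain_cat; lia.
  - move=> k vk; have := mono (d + e + 0) (d + e + k).
    rewrite !valE vk orbT !altitude_mountain_cat {1}/altitude take0 big_nil.
    by move=> /(_ isT isT); lia.
  - move=> k l vk vl kl; have := mono (d + e + k) (d + e + l).
    rewrite !valE vk vl !orbT !altitude_mountain_cat.
    by move=> /(_ isT isT); lia.
have valI k : valley (mountain (d, e) ++ w) k ->
    exists2 k', k = d + e + k' & (k' == 0) || valley w k'.
  move=> vk; have kde : d + e <= k.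
    by move: vk; rewrite valley_mountain_cat //; lia.
  by exists (k - (d + e)); [lia|rewrite -valE subnKC].
have alt0 k : (k == 0) || valley w k -> (0 <= altitude w k)%R.
  by case/orP => [/eqP->|/val//]; rewrite /altitude take0 big_nil.
split.
- move=> k; rewrite size_cat size_mountain => kw.
  have [kde|kde] := leqP k (d + e).
    by rewrite altitude_catl ?size_mountain // altitude_mountain //; case: leqP; lia.
  have := pos (k - (d + e)); have := altitude_mountain_cat d e w (k - (d + e)).
  by rewrite subnKC ?(ltnW kde) // => ->; lia.
- by rewrite size_cat size_mountain altitude_mountain_cat; lia.
- by move=> k /valI[k' -> /alt0]; rewrite altitude_mountain_cat; lia.
- move=> k l /valI[k' -> vk] /valI[l' -> vl] kl; rewrite !altitude_mountain_cat.
  have kl' : k' <= l' by lia.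
  suff : (altitude w k' <= altitude w l')%R by lia.
  case/orP: vk kl' => [/eqP-> _|vk kl'].
    by rewrite {1}/altitude take0 big_nil; apply: alt0.
  case/orP: vl kl' => [/eqP-> kl'|vl kl']; last exact: mono.
  by have -> : k' = 0 by lia.
Qed.

Lemma nondecreasing_from_blocks_path h bs c : nondecreasing_from h (blocks_path h bs c).
Proof.
elim: bs h => [|[a b] bs IH] h /=.
  by apply/nondecreasing_from_mountain; lia.
apply/nondecreasing_from_mountain_cat; rewrite ?head_blocks_path //; first by lia.
split; first by lia.
by have -> : h + (a + b + 1 - (a + 1)) = h + b by lia.
Qed.

Lemma nseq_prefix (x : bool) w :
  exists k s, w = nseq k x ++ s /\ head (~~ x) s = ~~ x.
Proof.
elim: w => [|b w [k [s [-> hs]]]]; first by exists 0, [::].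
have [->|bx] := eqVneq b x; first by exists k.+1, s.
by exists 0, (b :: nseq k x ++ s); split=> //=; case: b x bx {hs} => -[].
Qed.

(** Strong induction on the length: a maximal run of up steps and the maximal run of down steps
    after it form the first mountain, which is the last one if nothing remains and comes from a
    block otherwise. *)
Lemma nondecreasing_from_blocks h w : head false w = true ->
  nondecreasing_from h w -> exists bs c, w = blocks_path h bs c.
Proof.
have [N] := ubnP (size w); elim: N h w => // N IH h w sw hw.
have [d [v [Ew hv]]] := nseq_prefix true w.
have [e [w' [Ev hw']]] := nseq_prefix false v.
have {}Ew : w = mountain (d, e) ++ w' by rewrite Ew Ev -catA.
have d0 : 0 < d.
  by case: d Ew => // Ew; case: e Ev Ew => [|e] Ev Ew; move: hw hv; rewrite Ew Ev //= => ->.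
move=> ndw; have [w'0|hw''] : w' = [::] \/ head false w' = true.
- by case: (w') hw' => [|b s] /=; [left|right].
- subst w'; move: ndw; rewrite cats0 in Ew; rewrite Ew => ndw; exists [::], d.-1 => /=.
  have Ee : e = d + h.
    have [_ fin _ _] := ndw; move: fin; rewrite size_mountain altitude_mountain //.
    by case: leqP; lia.
  by congr (mountain (_, _)); lia.
have e0 : 0 < e.
  case: (e) Ev => // Ev; move: hv hw''; rewrite Ev /=.
  by case: (w') => //= b s ->.
move: ndw; rewrite Ew => /nondecreasing_from_mountain_cat[] // ed ndw'.
have sw' : size w' < N by move: sw; rewrite Ew size_cat size_mountain; lia.
have [bs [c Ew']] := IH _ _ sw' hw'' ndw'.
(* Solves [(a + b + 1, a + 1) = (d, e)], using [0 < e <= d]. *)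
exists ((e.-1, d - e) :: bs), c; rewrite /= -Ew'.
by congr (mountain (_, _) ++ _); lia.
Qed.

Lemma nondecreasing_dyck_pathsP N w : 0 < N ->
  nondecreasing_dyck_paths N w <->
  exists bs c, w = blocks_path 0 bs c /\
    \sum_(ab <- bs) (ab.1 + ab.2 + 1) + c + 1 = N.
Proof.
move=> N0; split=> [[[sw pos fin] mono]|[bs [c [-> sbc]]]].
  have [bs [c Ew]] : exists bs c, w = blocks_path 0 bs c.
    apply: nondecreasing_from_blocks.
      (* The path is nonempty as [0 < N], and a first step down would lead below the axis. *)
      have := pos 1; case: w sw {pos fin mono} => [|[] w] /=; first by lia.
        by [].
      by rewrite /altitude /= take0 big_seq1 => _ /(_ isT).
    split=> // [k kw||k vk]; rewrite ?GRing.add0r //; first exact: pos.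
    by apply: pos; move: vk; rewrite /valley; lia.
  by exists bs, c; split=> //; move: sw; rewrite Ew size_blocks_path; lia.
have [pos fin _ mono] := nondecreasing_from_blocks_path 0 bs c.
split=> //; split=> [|k /pos|].
- by rewrite size_blocks_path; lia.
- by rewrite GRing.add0r.
- by move: fin; rewrite GRing.add0r.
Qed.

(** * The three bijections *)

Lemma compatibleP n (S : {set 'I_n.+1} * {set 'I_n}) : compatible S <-> separated S.
Proof. by split; [exact: compatible_separated|exact: separated_compatible]. Qed.

Lemma phi_bij n : set_bij (perfect_matchings (2 * n + 1)) (compatible_pairs n) (@phi n).
Proof.
split.
- by move=> P pP; apply/compatibleP/phi_separated.
- by move=> P Q /set_mem pP /set_mem pQ; apply: phi_inj.
- by move=> S /compatibleP/phi_surj[P pP <-]; exists P.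
Qed.

(** Pairs correspond to words, words to block lists, and block lists to paths; the word length
    [n.+1] matches the half-length [n + 2] because the last mountain has [c + 1] up steps. *)
Lemma theta_bij n :
  set_bij (compatible_pairs n) (nondecreasing_dyck_paths (n + 2)) (@theta n).
Proof.
have n2 : 0 < n + 2 by lia.
split.
- move=> S /compatibleP sS; apply/(nondecreasing_dyck_pathsP _ n2).
  have gS := theta_word_good sS.
  rewrite /theta path_of_wordE ?size_theta_word //.
  have := size_theta_word S; rewrite -{1}(split_blocks_goodK gS); case: (split_blocks _) => bs c.
  by rewrite size_word_of => E; exists bs, c; split=> //; lia.
- move=> S S' /set_mem/compatibleP sS /set_mem/compatibleP sS'.
  have gS := theta_word_good sS; have gS' := theta_word_good sS'.
  rewrite /theta !path_of_wordE ?size_theta_word // => /blocks_path_inj[E1 E2].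
  apply: theta_word_inj => //; rewrite -(split_blocks_goodK gS) -(split_blocks_goodK gS').
  by rewrite [split_blocks (theta_word S)]surjective_pairing E1 E2 -surjective_pairing.
- move=> _ /(nondecreasing_dyck_pathsP _ n2)[bs [c [-> sbc]]].
  have gw := path_word_of LU (bs, c).
  have sw : size (word_of (bs, c)) = n.+1 by rewrite size_word_of; lia.
  exists (pair_of_word n (word_of (bs, c))).
    exact/compatibleP/pair_of_word_separated.
  by rewrite /theta pair_of_wordK // path_of_wordE // /word_of split_blocksK.
Qed.

(** The rung of column [2 * j.+1] is present exactly when neither adjacent position, [(2 * j).+1] or
    [2 * j.+1], is selected, which is the case of the letter [LO]. *)
Lemma psi_theta_phi n (P : {set {set vertex (2 * n + 1)}}) : perfect_matching P ->
  psi P = theta (phi P).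
Proof.
move=> pP; rewrite /psi /theta; congr path_of_word; rewrite /psi_word /theta_word.
congr (_ :: _); first by rewrite inE muln0.
have -> : iota 1 n = [seq (val j).+1 | j <- enum 'I_n].
  by rewrite (map_comp succn val) val_enum_ord -(iotaDl 1 0 n).
rewrite -map_comp; apply: eq_map => j /=.
have jn := ltn_ord j; have km : 2 * j.+1 <= 2 * n + 1 by lia.
rewrite theta_letter_cases; last exact: phi_separated.
rewrite in_phi1 // in_phi2 // /psi_letter.
have E1 := in_phi1 (lift ord0 j) pP; have E2 := in_phi2 j pP.
rewrite inE in E1; rewrite inE /= in E2; rewrite E1 E2 rung_matching //.
have -> : (2 * j.+1).-1 = (2 * j).+1 by lia.
have -> : 2 * j.+1 < 2 * n + 1 by lia.
have -> : lift ord0 j = j.+1 :> nat by [].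
by case: (_ \in P); case: (_ \in P).
Qed.

Theorem mainTheorem1 (n : nat) :
  [/\ set_bij (perfect_matchings (2 * n + 1)) (compatible_pairs n) (@phi n),
      set_bij (compatible_pairs n) (nondecreasing_dyck_paths (n + 2)) (@theta n)
    & set_bij (perfect_matchings (2 * n + 1)) (nondecreasing_dyck_paths (n + 2))
        (@psi n)].
Proof.
split; [exact: phi_bij|exact: theta_bij|].
have := set_bij_comp (phi_bij n) (theta_bij n).
by apply: eq_set_bijRL => P /set_mem pP /=; rewrite psi_theta_phi.
Qed.
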